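(* Let $\gamma\in\{0,1,\dots,n-2\}$, $\varepsilon\in(0,1)$, and let $G^{(0)}$ be an initial graph on $n$ vertices. Consider any sequence of edge insertions that yields a final graph $G$. If $G$ is locally $\gamma$-sparse, then $\textsc{Lazy-Alg}\!\left(\varphi=1,\,k=\frac{4(\gamma+1)}{\varepsilon}\right)$ has approximation ratio $\frac{1}{1-\varepsilon}$ (i.e., at every time step, for every vertex $v$, $\widetilde{\mathcal{B}}_2(v)\subseteq\mathcal{B}_2(v)$ and $\mathbb{E}[|\widetilde{\mathcal{B}}_2(v)|]\ge(1-\varepsilon)|\mathcal{B}_2(v)|$) and amortized update cost $O\!\left(\frac{\gamma+1}{\varepsilon}\right)$ per edge insertion.
   Context: For a vertex $x$ of a graph: $N(x)$ is its neighborhood, $\deg_x=|N(x)|$, $L_1(x)=N(x)$, $L_2(x)$ the set of vertices at distance exactly $2$ from $x$, $\mathcal{B}_1(x)=N(x)\cup\{x\}$, $\mathcal{B}_2(x)$ the set of vertices at distance at most $2$ from $x$. For $V'\subseteq V$, $G[V']$ is the induced subgraph. Locally $\gamma$-sparse: a graph $G=(V,E)$ on $n$ vertices is locally $\gamma$-sparse if for each vertex $u\in V$: (i) every $v\in L_1(u)$ has degree at most $\gamma$ in $G[L_1(u)]$, and (ii) every $w\in L_2(u)$ has degree at most $\gamma+1$ in $G[L_1(u)\cup\{w\}]$. Algorithm $\textsc{Lazy-Alg}(\varphi,k)$: each vertex $x$ stores sets $\widetilde{\mathcal{B}}_1(x)$, $\widetilde{\mathcal{B}}_2(x)$ and counters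 $\delta_x,\Delta_x$, initialized on $G^{(0)}$ as $\delta_x=0$, $\Delta_x=\deg_x$, $\widetilde{\mathcal{B}}_1(x)=\mathcal{B}_1(x)$, $\widetilde{\mathcal{B}}_2(x)=\mathcal{B}_2(x)$. On insertion of $(u,v)$ (added to the graph), for $x=u$ then $x=v$, with $y$ the other endpoint: (1) $\widetilde{\mathcal{B}}_1(x)\gets\widetilde{\mathcal{B}}_1(x)\cup\{y\}$; (2) $\widetilde{\mathcal{B}}_2(x)\gets\widetilde{\mathcal{B}}_2(x)\cup\widetilde{\mathcal{B}}_1(y)$; (3) $\delta_x\gets\delta_x+1$; (4) if $\delta_x\ge\varphi\Delta_x$, set $\Delta_x\gets\Delta_x+\delta_x$, $\delta_x\gets0$ and for each $z\in N(x)$ do $\widetilde{\mathcal{B}}_2(z)\gets\widetilde{\mathcal{B}}_2(z)\cup\widetilde{\mathcal{B}}_1(x)$; otherwise choose $k$ vertices $w_1,\dots,w_k\in N(x)$ uniformly at random and do $\widetilde{\mathcal{B}}_2(w_i)\gets\widetilde{\mathcal{B}}_2(w_i)\cup\widetilde{\mathcal{B}}_1(x)$. Cost: $T(S)$ is the number of set-union operations in steps (1), (2), (4) on sequence $S$; amortized cost $\hat c$ means $T(S)\le\hat c|S|$. *)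

(* Defs.v *)
From HB Require Import structures.
From mathcomp Require Import all_boot all_order all_algebra.
From mathcomp Require Import reals.

Set Implicit Arguments.
Unset Strict Implicit.
Unset Printing Implicit Defensive.

Import Order.TTheory GRing.Theory Num.Theory.
Local Open Scope ring_scope.

Section Graphs.
Variable T : finType.
Implicit Types (e : rel T) (A : {set T}) (x y u v w : T).

Definition simple_graph e : Prop := symmetric e /\ irreflexive e.

Definition nbr e x : {set T} := [set y | e x y].

Definition deg e x : nat := #|nbr e x|.

Definition induced e A : rel T := [rel x y | [&& x \in A, y \in A & e x y]].

Definition dist_le e (d : nat) x y : bool :=
  [exists l : 'I_d.+1, [exists p : l.-tuple T, path e x p && (last x p == y)]].

Definition layer1 e x : {set T} := nbr e x.
Definition layer2 e x : {set T} := [set y | dist_le e 2 x y && ~~ dist_le e 1 x y].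
Definition ball1 e x : {set T} := nbr e x :|: [set x].
Definition ball2 e x : {set T} := [set y | dist_le e 2 x y].

Definition locally_sparse e (gamma : nat) : Prop :=
  forall u,
    (forall v, v \in layer1 e u ->
       (deg (induced e (layer1 e u)) v <= gamma)%N) /\
    (forall w, w \in layer2 e u ->
       (deg (induced e (layer1 e u :|: [set w])) w <= gamma.+1)%N).

Definition add_edge e (uv : T * T) : rel T :=
  [rel x y | [|| e x y, (x, y) == (uv.1, uv.2) | (x, y) == (uv.2, uv.1)]].

Definition graph_after e (S : seq (T * T)) : rel T := foldl add_edge e S.

Fixpoint valid_insertions e (S : seq (T * T)) : bool :=
  if S is uv :: S' then
    [&& uv.1 != uv.2, ~~ e uv.1 uv.2 & valid_insertions (add_edge e uv) S']
  else true.

End Graphs.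

(* Finitely supported distributions, as lists of (weight, outcome) pairs; an
   outcome may be listed several times, its probability being the sum of the
   corresponding weights. *)
Section Distributions.
Variable R : realType.

Definition dist (A : Type) : Type := seq (R * A).

Definition dret (A : Type) (a : A) : dist A := [:: (1, a)].

Definition dbind (A B : Type) (d : dist A) (f : A -> dist B) : dist B :=
  flatten [seq [seq (p.1 * q.1, q.2) | q <- f p.2] | p <- d].

(* Only meaningful (total mass 1) on a nonempty s. *)
Definition dunif (A : Type) (s : seq A) : dist A :=
  [seq ((size s)%:R^-1, a) | a <- s].

(* k independent uniform draws from s, hence with replacement. *)
Fixpoint dsample (A : Type) (k : nat) (s : seq A) : dist (seq A) :=
  if k is k'.+1 then
    dbind (dunif s) (fun w => dbind (dsample k' s) (fun ws => dret (w :: ws)))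
  else dret [::].

Definition expect (A : Type) (d : dist A) (f : A -> R) : R :=
  \sum_(p <- d) p.1 * f p.2.

Definition surely (A : Type) (d : dist A) (P : pred A) : bool :=
  all (fun p => (0 < p.1) ==> P p.2) d.

End Distributions.

Section LazyAlg.
Variables (R : realType) (T : finType).
Implicit Types (e : rel T) (x y : T) (A : {set T}).

(* st_cost counts the set-union operations performed so far. *)
Record state := State {
  st_B1 : T -> {set T};
  st_B2 : T -> {set T};
  st_delta : T -> nat;
  st_Delta : T -> nat;
  st_cost : nat }.

Implicit Type st : state.

Definition upd (V : Type) (f : T -> V) x (a : V) : T -> V :=
  fun z => if z == x then a else f z.

Definition init e : state :=
  {| st_B1 := ball1 e; st_B2 := ball2 e;
     st_delta := fun=> 0%N; st_Delta := deg e; st_cost := 0%N |}.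

Definition union_B1 x A st : state :=
  {| st_B1 := upd (st_B1 st) x (st_B1 st x :|: A); st_B2 := st_B2 st;
     st_delta := st_delta st; st_Delta := st_Delta st;
     st_cost := (st_cost st).+1 |}.

Definition union_B2 x A st : state :=
  {| st_B1 := st_B1 st; st_B2 := upd (st_B2 st) x (st_B2 st x :|: A);
     st_delta := st_delta st; st_Delta := st_Delta st;
     st_cost := (st_cost st).+1 |}.

Definition incr_delta x st : state :=
  {| st_B1 := st_B1 st; st_B2 := st_B2 st;
     st_delta := upd (st_delta st) x (st_delta st x).+1;
     st_Delta := st_Delta st; st_cost := st_cost st |}.

Definition reset_counters x st : state :=
  {| st_B1 := st_B1 st; st_B2 := st_B2 st;
     st_delta := upd (st_delta st) x 0%N;
     st_Delta := upd (st_Delta st) x (st_Delta st x + st_delta st x)%N;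
     st_cost := st_cost st |}.

Definition push_B1 x (zs : seq T) st : state :=
  foldl (fun st' z => union_B2 z (st_B1 st' x) st') st zs.

(* e is the graph that already contains the inserted edge (x, y). *)
Definition endpoint_update (phi : R) (k : nat) e x y st : dist R state :=
  let st1 := union_B1 x [set y] st in
  let st2 := union_B2 x (st_B1 st1 y) st1 in
  let st3 := incr_delta x st2 in
  if phi * (st_Delta st3 x)%:R <= (st_delta st3 x)%:R then
    dret R (push_B1 x (enum (nbr e x)) (reset_counters x st3))
  else
    dbind (dsample R k (enum (nbr e x))) (fun ws => dret R (push_B1 x ws st3)).

Definition insert_update (phi : R) (k : nat) e (uv : T * T) st : dist R state :=
  dbind (endpoint_update phi k e uv.1 uv.2 st)
        (endpoint_update phi k e uv.2 uv.1).

Fixpoint run_from (phi : R) (k : nat) e (S : seq (T * T)) st : dist R state :=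
  if S is uv :: S' then
    let e' := add_edge e uv in
    dbind (insert_update phi k e' uv st) (run_from phi k e' S')
  else dret R st.

Definition lazy_alg (phi : R) (k : nat) e (S : seq (T * T)) : dist R state :=
  run_from phi k e S (init e).

End LazyAlg.

(* The algorithm's output is a genuine probability distribution: the
   neighborhoods it samples from are never empty. *)
Section Mass.
Variable R : realType.

Definition is_distr (A : Type) (d : dist R A) : Prop :=
  all (fun p => 0 < p.1) d /\ expect d (fun=> 1) = 1.

Lemma is_distr_ret (A : Type) (a : A) : is_distr (dret R a).
Proof. by rewrite /is_distr /expect /= big_seq1 ltr01 mulr1. Qed.

Lemma is_distr_bind (A B : Type) (d : dist R A) (f : A -> dist R B) :
  is_distr d -> (forall a, is_distr (f a)) -> is_distr (dbind d f).
Proof.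
move=> [d_gt0 d_mass] Hf; split.
  elim: d d_gt0 {d_mass} => //= p d IH /andP[p0 /IH Hd].
  rewrite all_cat {}Hd andbT all_map.
  by apply: sub_all (Hf p.2).1 => q /= q0; apply: mulr_gt0.
rewrite -[RHS]d_mass /expect big_flatten big_map /=.
apply: eq_bigr => p _; rewrite big_map.
rewrite -{2}(Hf p.2).2 /expect mulr_sumr.
by apply: eq_bigr => q _; rewrite mulrA.
Qed.

Lemma is_distr_unif (A : Type) (s : seq A) :
  (0 < size s)%N -> is_distr (dunif R s).
Proof.
move=> s_gt0; split.
  by rewrite all_map; apply/allT => a /=; rewrite invr_gt0 ltr0n.
rewrite /expect big_map /= big_const_seq count_predT iter_addr_0 mulr1.
by rewrite -[LHS]mulr_natr mulVf // pnatr_eq0 -lt0n.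
Qed.

Lemma is_distr_sample (A : Type) (k : nat) (s : seq A) :
  (0 < size s)%N -> is_distr (dsample R k s).
Proof.
move=> s_gt0; elim: k => [|k IH]; first exact: is_distr_ret.
apply: is_distr_bind => [|w]; first exact: is_distr_unif.
by apply: is_distr_bind => // ws; apply: is_distr_ret.
Qed.

Lemma is_distr_lazy_alg (T : finType) (phi : R) (k : nat) (e : rel T)
    (S : seq (T * T)) : is_distr (lazy_alg phi k e S).
Proof.
have Hend (e' : rel T) x y st : e' x y ->
    is_distr (endpoint_update phi k e' x y st).
  move=> exy; rewrite /endpoint_update; case: ifP => _.
    exact: is_distr_ret.
  apply: is_distr_bind => [|ws]; last exact: is_distr_ret.
  apply: is_distr_sample; rewrite -cardE; apply/card_gt0P.
  by exists y; rewrite inE.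
rewrite /lazy_alg; elim: S e (init e) => [|uv S IH] e st /=.
  exact: is_distr_ret.
apply: is_distr_bind => [|st']; last exact: IH.
apply: is_distr_bind => [|st']; apply: Hend.
  by rewrite /add_edge /= eqxx orbT.
by rewrite /add_edge /= eqxx !orbT.
Qed.

End Mass.

(* Main.v *)
Require Import Defs.
From HB Require Import structures.
From mathcomp Require Import all_boot all_order all_algebra.
From mathcomp Require Import reals.
From mathcomp Require Import lra zify.

Set Implicit Arguments.
Unset Strict Implicit.
Unset Printing Implicit Defensive.

Import Order.TTheory GRing.Theory Num.Theory.
Local Open Scope ring_scope.

(* Fix vertices v and x with x recorded as a neighbour of v, and let M be the
   number of recorded neighbours of x missing from the stored ball B2 of v.
   Inserting an edge at x raises M by at most 1 and then resets it to 0 unless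
   none of the k samples among the d neighbours of x is v, which has probability
   q = (1 - 1/d)^k <= d / (d + k); hence E[M] <= d / k by induction, full pushes
   only helping.  Summing over x in N(v), the expected number of missing vertices
   is at most (sum of deg x over N(v)) / k.  Sparsity bounds the codegree of two
   distinct vertices by gamma + 1 in every intermediate graph, so by double
   counting this is at most 2 (gamma + 1) |B2(v)| / k <= (eps / 2) |B2(v)|.
   For the cost, twice the sum of the counters delta is a potential: a full push
   at x costs Delta + delta <= 2 delta, so every half-insertion has amortized cost
   at most k + 4. *)

(** * Monad laws and expectations for finite distributions *)

Section Distributions.
Variable R : realType.

Lemma dbind_cat (A B : Type) (d1 d2 : dist R A) (f : A -> dist R B) :
  dbind (d1 ++ d2) f = dbind d1 f ++ dbind d2 f.
Proof. by rewrite /dbind map_cat flatten_cat. Qed.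

Lemma dbind_scale (A B : Type) (r : R) (d : dist R A) (f : A -> dist R B) :
  dbind [seq (r * p.1, p.2) | p <- d] f = [seq (r * p.1, p.2) | p <- dbind d f].
Proof.
elim: d => //= p d IH; rewrite /dbind /= map_cat; congr (_ ++ _) => //.
by rewrite -map_comp; apply: eq_map => q /=; rewrite mulrA.
Qed.

Lemma dbindA (A B C : Type) (d : dist R A) (f : A -> dist R B)
    (g : B -> dist R C) :
  dbind (dbind d f) g = dbind d (fun a => dbind (f a) g).
Proof.
elim: d => //= p d IH.
by rewrite {2}/dbind /= dbind_cat dbind_scale IH.
Qed.

Lemma dbind_ret_l (A B : Type) (a : A) (f : A -> dist R B) :
  dbind (dret R a) f = f a.
Proof.
rewrite /dbind /= cats0 -[RHS]map_id.
by apply: eq_map => -[r b] /=; rewrite mul1r.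
Qed.

Lemma dbind_ret_r (A : Type) (d : dist R A) : dbind d (dret R (A:=A)) = d.
Proof.
elim: d => //= -[r a] d IH.
by rewrite /dbind /= mulr1; congr cons.
Qed.

Lemma all_dbind (A B : Type) (P : pred A) (Q : pred B) (d : dist R A)
    (f : A -> dist R B) :
  all (fun p => P p.2) d -> (forall a, P a -> all (fun p => Q p.2) (f a)) ->
  all (fun p => Q p.2) (dbind d f).
Proof.
move=> Pd PQ; elim: d Pd => //= p d IH /andP[/PQ Qp /IH Qd].
by rewrite /dbind /= all_cat Qd andbT all_map.
Qed.

Lemma surely_all (A : Type) (P : pred A) (d : dist R A) :
  all (fun p => P p.2) d -> surely d P.
Proof. by apply: sub_all => p /= ->; rewrite implybT. Qed.

Lemma expect_dbind (A B : Type) (d : dist R A) (f : A -> dist R B) (g : B -> R) :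
  expect (dbind d f) g = expect d (fun a => expect (f a) g).
Proof.
rewrite /expect big_flatten big_map; apply: eq_bigr => p _.
by rewrite big_map mulr_sumr; apply: eq_bigr => q _; rewrite mulrA.
Qed.

Lemma expect_ret (A : Type) (a : A) (f : A -> R) : expect (dret R a) f = f a.
Proof. by rewrite /expect big_seq1 mul1r. Qed.

Lemma expectZ (A : Type) (d : dist R A) (c : R) (f : A -> R) :
  expect d (fun a => c * f a) = c * expect d f.
Proof. by rewrite /expect mulr_sumr; apply: eq_bigr => p _; rewrite mulrCA. Qed.

Lemma expectD (A : Type) (d : dist R A) (f g : A -> R) :
  expect d (fun a => f a + g a) = expect d f + expect d g.
Proof. by rewrite /expect -big_split; apply: eq_bigr => p _; rewrite mulrDr. Qed.

Lemma expect_sum (A I : Type) (d : dist R A) (r : seq I) (P : pred I)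
    (f : I -> A -> R) :
  expect d (fun a => \sum_(i <- r | P i) f i a) =
  \sum_(i <- r | P i) expect d (f i).
Proof.
by rewrite /expect exchange_big; apply: eq_bigr => p _; rewrite mulr_sumr.
Qed.

Lemma expect_const (A : Type) (d : dist R A) (c : R) :
  is_distr d -> expect d (fun=> c) = c.
Proof.
case=> _ d1; transitivity (expect d (fun=> c * 1)); first by rewrite mulr1.
by rewrite expectZ d1 mulr1.
Qed.

(** The predicate [P] carries an invariant of the support, so [f] and [g] need comparing only on
    outcomes that satisfy it. *)
Lemma ler_expect (A : Type) (P : pred A) (d : dist R A) (f g : A -> R) :
  is_distr d -> all (fun p => P p.2) d -> (forall a, P a -> f a <= g a) ->
  expect d f <= expect d g.
Proof.
move=> [d_gt0 _] Pd fg; rewrite /expect.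
elim: d d_gt0 Pd => [|p d IH] /=; first by rewrite !big_nil.
move=> /andP[p0 d0] /andP[Pp Pd]; rewrite !big_cons.
by apply: lerD; [rewrite ler_wpM2l ?fg // ltW | exact: IH].
Qed.

Lemma expect_unif (A : Type) (s : seq A) (f : A -> R) :
  expect (dunif R s) f = (size s)%:R^-1 * \sum_(a <- s) f a.
Proof. by rewrite /expect big_map mulr_sumr. Qed.

Lemma all_dsample (A : eqType) (k : nat) (s : seq A) :
  all (fun p => all (mem s) p.2 && (size p.2 == k)) (dsample R k s).
Proof.
elim: k => [|k IH] //=.
apply: (@all_dbind _ _ (mem s) (fun ws => all (mem s) ws && (size ws == k.+1))).
  by rewrite all_map; apply/allP.
move=> w sw.
apply: (@all_dbind _ _ (fun ws => all (mem s) ws && (size ws == k))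
  (fun ws => all (mem s) ws && (size ws == k.+1)) _ _ IH) => ws.
by case/andP=> Pws /eqP szws; rewrite /= Pws szws eqxx !andbT.
Qed.

(** The draws are independent, and since [s] has no duplicates each of them avoids [v] with
    probability $1 - 1/|s|$. *)
Lemma expect_sample_notin (A : eqType) (k : nat) (s : seq A) (v : A) :
  uniq s -> v \in s ->
  expect (dsample R k s) (fun ws => (v \notin ws)%:R) =
  (1 - (size s)%:R^-1) ^+ k.
Proof.
move=> s_uniq vs; elim: k => [|k IH] /=; first by rewrite expect_ret.
have s0 : (size s)%:R != 0 :> R by rewrite pnatr_eq0; case: (s) vs.
rewrite expect_dbind expect_unif.
(* The indicator of avoiding [v] factors into that of the first draw and that of the remaining
   ones. *)
rewrite (eq_bigr (fun w => (v != w)%:R * (1 - (size s)%:R^-1) ^+ k)); last first.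
  move=> w _; rewrite expect_dbind -IH -expectZ /expect; apply: eq_bigr => p _.
  by rewrite big_seq1 /= mul1r inE negb_or -natrM mulnb.
rewrite -mulr_suml mulrA exprS; congr (_ * _).
have -> : \sum_(w <- s) (v != w)%:R = (size s)%:R - 1 :> R.
  rewrite (bigD1_seq v) //= eqxx add0r.
  rewrite (eq_bigr (fun=> 1)); last by move=> i; rewrite eq_sym => ->.
  rewrite -[in RHS](count_predC (pred1 v) s) count_uniq_mem // vs natrD addrC addKr.
  by rewrite big_const_seq iter_addr_0.
by rewrite mulrBr mulVf // mulr1.
Qed.

End Distributions.

(** * Balls, growing graphs and codegrees *)

Section Graphs.
Variable T : finType.
Implicit Types (e : rel T) (x y z u v w : T) (S : seq (T * T)).

Lemma card_bigcup_leq (I : finType) (P : pred I) (f : I -> {set T}) :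
  (#|\bigcup_(i | P i) f i| <= \sum_(i | P i) #|f i|)%N.
Proof.
elim/big_rec2: _ => [|i n U _ leU]; first by rewrite cards0.
by apply: leq_trans (leq_card_setU _ _) _; rewrite leq_add2l.
Qed.

Lemma ball2P e x y :
  reflect [\/ y = x, e x y | exists2 z, e x z & e z y] (y \in ball2 e x).
Proof.
rewrite inE; apply: (iffP existsP) => [[[l /= lt_l3]] /existsP[[p /= /eqP szp]]|].
  case/andP; case: p szp => [|a [|b [|c p]]] /=.
  - by move=> _ _ /eqP <-; constructor 1.
  - by move=> _ /andP[exa _] /eqP <-; constructor 2.
  - by move=> _ /and3P[exa eab _] /eqP <-; constructor 3; exists a.
  - by move=> szp; move: lt_l3; rewrite -szp.
case=> [->|exy|[z exz ezy]].
- by exists (inord 0); apply/existsP; rewrite inordK //; exists [tuple] => /=.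
- exists (inord 1); apply/existsP; rewrite inordK //; exists [tuple y] => /=.
  by rewrite exy eqxx.
- exists (inord 2); apply/existsP; rewrite inordK //; exists [tuple z; y] => /=.
  by rewrite exz ezy eqxx.
Qed.

Lemma ball2S e1 e2 x : subrel e1 e2 -> ball2 e1 x \subset ball2 e2 x.
Proof.
move=> s12; apply/subsetP => y /ball2P[->|/s12 h|[z /s12 h1 /s12 h2]]; apply/ball2P.
- by constructor 1.
- by constructor 2.
- by constructor 3; exists z.
Qed.

Lemma add_edge_sub e uv : subrel e (add_edge e uv).
Proof. by move=> x y; rewrite /add_edge /= => ->. Qed.

Lemma graph_after_sub e S : subrel e (graph_after e S).
Proof.
elim: S e => [|uv S IH] e x y //= exy.
exact/IH/add_edge_sub.
Qed.

Lemma graph_after_take_sub e S t :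
  subrel (graph_after e (take t S)) (graph_after e S).
Proof.
by move=> x y h; rewrite -{1}(cat_take_drop t S) /graph_after foldl_cat; apply: graph_after_sub.
Qed.

Lemma valid_take e S t : valid_insertions e S -> valid_insertions e (take t S).
Proof.
elim: S e t => [|uv S IH] e [|t] //= /and3P[-> -> /=]; exact: IH.
Qed.

Lemma add_edge_simple e uv :
  uv.1 != uv.2 -> simple_graph e -> simple_graph (add_edge e uv).
Proof.
move=> ne [sym irr]; split=> [x y|x]; rewrite /add_edge /= !xpair_eqE.
  by rewrite sym; case: (e y x) => //=; rewrite orbC andbC [X in _ || X]andbC.
rewrite irr /=; apply/negP => /orP[]/andP[/eqP -> /eqP h]; case/eqP: ne => //.
Qed.

Lemma graph_after_simple e S :
  valid_insertions e S -> simple_graph e -> simple_graph (graph_after e S).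
Proof.
elim: S e => //= uv S IH e /and3P[ne _ vS] simple_e.
exact/IH/add_edge_simple.
Qed.

(** Two successive one-sided updates, matching the two halves of an insertion. *)
Lemma nbr_add_edge e a b z : a != b ->
  nbr (add_edge e (a, b)) z =
  upd (upd (nbr e) a (b |: nbr e a)) b
      (a |: upd (nbr e) a (b |: nbr e a) b) z.
Proof.
move=> ne; apply/setP => w; rewrite /upd (eq_sym b a) (negbTE ne).
rewrite [LHS]inE /add_edge /= !xpair_eqE.
have [->|zb] := eqVneq z b.
  by rewrite (eq_sym b a) (negbTE ne) /= !inE orbC.
by have [->|za] := eqVneq z a; rewrite /= ?orbF ?inE // orbC.
Qed.

(** Cases on the position of [w] seen from [u]: if adjacent, condition (i) gives at most [g] common
    neighbours; at distance 2, condition (ii) gives at most [g.+1]; further away there are none. *)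
Lemma locally_sparse_codeg e g u w : simple_graph e -> locally_sparse e g ->
  u != w -> (#|nbr e u :&: nbr e w| <= g.+1)%N.
Proof.
move=> [sym irr] sparse ne; have [s1 s2] := sparse u.
have [euw|neuw] := boolP (e u w).
  apply: leq_trans (leqW (s1 w _)); last by rewrite inE.
  apply/subset_leq_card/subsetP => z; rewrite inE !in_set /induced /layer1 /= => /andP[h1 h2].
  by rewrite /= !inE euw h1 h2.
have [wL2|wL2] := boolP (w \in layer2 e u).
  apply: leq_trans (s2 w wL2).
  apply/subset_leq_card/subsetP => z; rewrite inE !in_set /induced /layer1 /= => /andP[h1 h2].
  by rewrite /= !inE eqxx orbT h1 h2.
rewrite leqW // (_ : _ :&: _ = set0) ?cards0 //; apply/setP => z; rewrite !inE.
apply/negP => /andP[euz ewz]; case/negP: wL2; rewrite inE.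
have : w \in ball2 e u by apply/ball2P; constructor 3; exists z; rewrite // sym.
rewrite inE => -> /=; apply/negP => /existsP[[l /= ltl]] /existsP[[p /= /eqP szp]].
case: p szp => [|c [|d p]] /= szp.
- by rewrite (negbTE ne).
- by rewrite andbT => /andP[euc /eqP ec]; rewrite -ec euc in neuw.
- by rewrite -szp in ltl.
Qed.

(** Double counting of walks [v], [x], [w]. Their ends lie in the 2-ball; the end [w = v] accounts
    for $\deg v$ walks, every other end for at most [g.+1]. *)
Lemma sum_deg_nbr e g v : symmetric e ->
  (forall w, v != w -> #|nbr e v :&: nbr e w| <= g.+1)%N ->
  (\sum_(x in nbr e v) #|nbr e x| <= (g.+1).*2 * #|ball2 e v|)%N.
Proof.
move=> sym codeg.
have -> : (\sum_(x in nbr e v) #|nbr e x| = \sum_w #|nbr e v :&: nbr e w|)%N.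
  under eq_bigr => x _ do rewrite -sum1_card.
  rewrite (exchange_big_dep predT) //=; apply: eq_bigr => w _.
  by rewrite -sum1_card; apply: eq_bigl => x; rewrite !inE (sym w).
rewrite (bigID (mem (ball2 e v))) /= [X in (_ + X)%N]big1 ?addn0; last first.
  move=> w wB; apply/eqP; rewrite cards_eq0; apply/set0Pn => -[x].
  rewrite !inE => /andP[evx ewx]; case/negP: wB; apply/ball2P; constructor 3.
  by exists x; rewrite // sym.
have vB : v \in ball2 e v by apply/ball2P; constructor 1.
rewrite (bigD1 v) //= setIid.
have h1 : (#|nbr e v| <= #|ball2 e v|)%N.
  by apply/subset_leq_card/subsetP => y; rewrite inE => evy; apply/ball2P; constructor 2.
have h2 : (\sum_(w in ball2 e v | w != v) #|nbr e v :&: nbr e w| <= #|ball2 e v| * g.+1)%N.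
  rewrite -sum_nat_const [X in (_ <= X)%N](bigD1 v) //=.
  apply: leq_trans (leq_addl _ _); apply: leq_sum => w /andP[_ wv].
  by apply: codeg; rewrite eq_sym.
(* Each of the two parts is at most $(g+1)|B_2(v)|$. *)
nia.
Qed.

End Graphs.

(** * One endpoint update: its effect on the state and its amortized cost *)

Section LazyAlg.
Variables (R : realType) (T : finType).
Implicit Types (e : rel T) (x y z v w : T) (F : T -> {set T}) (st : state T).

(** Steps (1) to (3) of the algorithm at [x], common to the full push and the sampled push. *)
Definition record_arc x y st : state T :=
  let st1 := union_B1 x [set y] st in
  incr_delta x (union_B2 x (st_B1 st1 y) st1).

Lemma push_B1E x zs st :
  [/\ st_B1 (push_B1 x zs st) = st_B1 st,
      st_delta (push_B1 x zs st) = st_delta st,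
      st_Delta (push_B1 x zs st) = st_Delta st &
      st_cost (push_B1 x zs st) = (st_cost st + size zs)%N].
Proof.
elim: zs st => [|z zs IH] st /=; first by rewrite addn0.
by case: (IH (union_B2 z (st_B1 st x) st)) => -> -> -> ->; rewrite /= addSnnS.
Qed.

Lemma push_B1_B2 x zs st z :
  st_B2 (push_B1 x zs st) z =
  if z \in zs then st_B2 st z :|: st_B1 st x else st_B2 st z.
Proof.
elim: zs st => [|a zs IH] st //=.
rewrite IH /= /upd inE; case: (eqVneq z a) => [->|_] //=.
by case: ifP => // _; rewrite -setUA setUid.
Qed.

Lemma endpoint_updateE k e x y st :
  endpoint_update (1 : R) k e x y st =
  if (st_Delta st x <= (st_delta st x).+1)%N then
    dret R (push_B1 x (enum (nbr e x)) (reset_counters x (record_arc x y st)))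
  else dbind (dsample R k (enum (nbr e x)))
         (fun ws => dret R (push_B1 x ws (record_arc x y st))).
Proof. by rewrite /endpoint_update /= /upd eqxx mul1r ler_nat. Qed.

Lemma endpoint_update_all (P : pred (state T)) k e x y st :
  ((st_Delta st x <= (st_delta st x).+1)%N ->
    P (push_B1 x (enum (nbr e x)) (reset_counters x (record_arc x y st)))) ->
  (forall ws : seq T, {subset ws <= nbr e x} -> size ws = k ->
    P (push_B1 x ws (record_arc x y st))) ->
  all (fun p => P p.2) (endpoint_update (1 : R) k e x y st).
Proof.
move=> Pfull Psample; rewrite endpoint_updateE; case: ifP => [/Pfull|_].
  by rewrite /= andbT.
apply: (@all_dbind _ _ _
  (fun ws => all (mem (enum (nbr e x))) ws && (size ws == k))
  P _ _ (all_dsample R k (enum (nbr e x)))) => ws.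
move=> /andP[/allP sub /eqP sz]; rewrite /= andbT; apply: Psample => // w.
by move=> /sub /=; rewrite mem_enum.
Qed.

Lemma is_distr_endpoint_update k e x y st : e x y ->
  is_distr (endpoint_update (1 : R) k e x y st).
Proof.
move=> exy; rewrite endpoint_updateE; case: ifP => _; first exact: is_distr_ret.
apply: is_distr_bind => [|ws]; last exact: is_distr_ret.
apply: is_distr_sample; rewrite -cardE; apply/card_gt0P.
by exists y; rewrite inE.
Qed.

(* [F z] is the set of neighbours of [z] processed so far: between the two halves
   of an insertion it is not a symmetric relation. *)
Definition state_inv F e (c : nat) st : bool :=
  [forall z, [&& st_B1 st z == z |: F z,
                 (st_delta st z + st_Delta st z == #|F z|)%N,
                 z |: F z \subset st_B2 st z &
                 st_B2 st z \subset ball2 e z]] &&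
  (st_cost st + (\sum_z st_delta st z).*2 <= c)%N.

(** In additive form, since subtraction of natural numbers truncates. *)
Lemma sum_upd (f : T -> nat) x a :
  (\sum_z upd f x a z + f x = \sum_z f z + a)%N.
Proof.
rewrite (bigD1 x) //= [in RHS](bigD1 x) //= /upd eqxx.
rewrite (eq_bigr f); last by move=> z /negbTE ->.
lia.
Qed.

(** The stored 1-ball of [x] becomes exact before it is pushed, and it is pushed only to neighbours
    of [x], whose 2-balls contain it. The increment [k + 4] pays for either branch. *)
Lemma endpoint_update_inv k e F c x y st :
  simple_graph e -> (forall z, F z \subset nbr e z) ->
  nbr e x = y |: F x -> y \notin F x -> state_inv F e c st ->
  all (fun p => state_inv (upd F x (y |: F x)) e (c + (k + 4)) p.2)
    (endpoint_update (1 : R) k e x y st).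
Proof.
move=> [sym irr] subF nbrx yF /andP[/forallP inv cost].
have exy : y \in nbr e x by rewrite nbrx setU11.
rewrite inE in exy.
have xy : x != y by apply: contraTneq exy => ->; rewrite irr.
have B1E z : st_B1 st z = z |: F z by case/and4P: (inv z) => /eqP.
have cntE z : (st_delta st z + st_Delta st z = #|F z|)%N.
  by case/and4P: (inv z) => _ /eqP.
have B2lo z : z |: F z \subset st_B2 st z by case/and4P: (inv z).
have B2hi z : st_B2 st z \subset ball2 e z by case/and4P: (inv z).
have B1x : st_B1 (record_arc x y st) x = x |: nbr e x.
  by rewrite /= /upd eqxx B1E nbrx setUCA [_ :|: [set y]]setUC.
have B1ok z : st_B1 (record_arc x y st) z == z |: upd F x (y |: F x) z.
  rewrite /upd; case: (eqVneq z x) => [->|zx]; first by rewrite B1x nbrx.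
  by rewrite /= /upd (negbTE zx) B1E.
have B2E z : st_B2 (record_arc x y st) z =
    if z == x then st_B2 st x :|: (y |: F y) else st_B2 st z.
  by rewrite /= /upd (eq_sym y) (negbTE xy) B1E.
have B2ok (ws : seq T) z : {subset ws <= nbr e x} ->
    (z |: upd F x (y |: F x) z \subset st_B2 (push_B1 x ws (record_arc x y st)) z) &&
    (st_B2 (push_B1 x ws (record_arc x y st)) z \subset ball2 e z).
  move=> sub; rewrite push_B1_B2 B1x.
  have lo3 : z |: upd F x (y |: F x) z \subset st_B2 (record_arc x y st) z.
    rewrite B2E /upd; case: (eqVneq z x) => [->|zx]; last exact: B2lo.
    rewrite setUCA subUset; apply/andP; split.
      by apply: subset_trans (subsetUr _ _); rewrite subsetUl.
    exact: subset_trans (B2lo x) (subsetUl _ _).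
  have hi3 : st_B2 (record_arc x y st) z \subset ball2 e z.
    rewrite B2E /upd; case: (eqVneq z x) => [->|zx]; last exact: B2hi.
    rewrite subUset B2hi /= subUset sub1set; apply/andP; split.
      by apply/ball2P; constructor 2.
    apply/subsetP => w /(subsetP (subF y)); rewrite inE => eyw.
    by apply/ball2P; constructor 3; exists y.
  case: ifP => [zws|_]; last by rewrite lo3.
  rewrite (subset_trans lo3 (subsetUl _ _)) /= subUset hi3 /=.
  have ezx : e z x by have := sub z zws; rewrite inE sym.
  apply/subsetP => w; rewrite in_setU1 inE => /orP[/eqP ->|exw]; apply/ball2P.
    by constructor 2.
  by constructor 3; exists x.
have cardx : #|y |: F x| = #|F x|.+1 by rewrite cardsU1 yF.
apply: endpoint_update_all => [full|ws sub szws].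
  set st3 := record_arc x y st.
  have [eB1 edelta eDelta ecost] := push_B1E x (enum (nbr e x)) (reset_counters x st3).
  rewrite /state_inv eB1 edelta eDelta ecost; apply/andP; split.
    apply/forallP => z; rewrite B1ok.
    have -> : st_B2 (push_B1 x (enum (nbr e x)) (reset_counters x st3)) z =
              st_B2 (push_B1 x (enum (nbr e x)) st3) z by rewrite !push_B1_B2.
    rewrite B2ok ?andbT; last by move=> w; rewrite mem_enum.
    rewrite /= /upd; case: (eqVneq z x) => [_|zx]; last by rewrite cntE.
    by rewrite eqxx cardx; have := cntE x; lia.
  (* With $\delta, \Delta$ the old counters at [x], the push makes $\delta + \Delta + 1 \le 2\delta
     + 2$ unions, and two more come from [record_arc]. Resetting $\delta$ releases a potential of
     $2\delta$, so the net cost is at most 4. *)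
  rewrite -cardE nbrx cardx /=.
  have := sum_upd (upd (st_delta st) x (st_delta st x).+1) x 0.
  have := sum_upd (st_delta st) x (st_delta st x).+1.
  have -> : upd (st_delta st) x (st_delta st x).+1 x = (st_delta st x).+1.
    by rewrite /upd eqxx.
  have := cntE x; lia.
set st3 := record_arc x y st.
have [eB1 edelta eDelta ecost] := push_B1E x ws st3.
rewrite /state_inv eB1 edelta eDelta ecost; apply/andP; split.
  apply/forallP => z; rewrite B1ok B2ok // andbT.
  rewrite /= /upd; case: (eqVneq z x) => [->|zx]; last by rewrite cntE.
  by rewrite cardx; have := cntE x; lia.
(* Here [k] pushes, the two unions of [record_arc], and 2 units of potential for the incremented
   counter. *)
rewrite szws /=; have := sum_upd (st_delta st) x (st_delta st x).+1; lia.
Qed.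

(** * Growth of the stored 2-balls and the expected number of missing vertices *)

Lemma endpoint_update_B2 k e x y st v :
  all (fun p => st_B2 st v \subset st_B2 p.2 v)
    (endpoint_update (1 : R) k e x y st).
Proof.
have mono3 : st_B2 st v \subset st_B2 (record_arc x y st) v.
  by rewrite /= /upd; case: (eqVneq v x) => [->|_]; rewrite ?subsetUl.
apply: (@endpoint_update_all (fun st' => st_B2 st v \subset st_B2 st' v)) => [_|ws _ _]; rewrite push_B1_B2; case: ifP => _ //.
  exact: subset_trans mono3 (subsetUl _ _).
exact: subset_trans mono3 (subsetUl _ _).
Qed.

(** This starts the bound for a newly recorded neighbour [y] of [x]: nothing recorded around [y] is
    missing at [x]. *)
Lemma endpoint_update_pull k e x y st : x != y ->
  all (fun p => st_B1 st y \subset st_B2 p.2 x)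
    (endpoint_update (1 : R) k e x y st).
Proof.
move=> xy.
have hit : st_B1 st y \subset st_B2 (record_arc x y st) x.
  by rewrite /= /upd eqxx eq_sym (negbTE xy) subsetUr.
apply: (@endpoint_update_all (fun st' => st_B1 st y \subset st_B2 st' x)) => [_|ws _ _]; rewrite push_B1_B2; case: ifP => _ //.
  exact: subset_trans hit (subsetUl _ _).
exact: subset_trans hit (subsetUl _ _).
Qed.

(** When [v] receives the push nothing stays missing, as the stored 1-ball of [x] then contains all
    of its neighbourhood; otherwise the stored ball of [v] can only grow. A full push reaches [v]
    with certainty. *)
Lemma expect_endpoint_update_miss k e x y st v :
  e x v -> nbr e x \subset y |: st_B1 st x ->
  expect (endpoint_update (1 : R) k e x y st)
    (fun st' => #|nbr e x :\: st_B2 st' v|%:R) <=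
  (1 - #|nbr e x|%:R^-1) ^+ k * #|nbr e x :\: st_B2 st v|%:R.
Proof.
move=> exv sub.
have d_gt0 : (0 < #|nbr e x|)%N by apply/card_gt0P; exists v; rewrite inE.
have q_ge0 : 0 <= 1 - #|nbr e x|%:R^-1 :> R.
  by rewrite subr_ge0 invf_le1 ?ltr0n // ler1n.
have B1x : nbr e x \subset st_B1 (record_arc x y st) x.
  by rewrite /= /upd eqxx setUC.
have hit ws st' : st_B1 st' = st_B1 (record_arc x y st) -> v \in ws ->
    #|nbr e x :\: st_B2 (push_B1 x ws st') v| = 0%N.
  move=> eB1 vws; apply/eqP; rewrite cards_eq0 setD_eq0 push_B1_B2 vws eB1.
  exact: subset_trans B1x (subsetUr _ _).
rewrite endpoint_updateE; case: ifP => _.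
  rewrite expect_ret hit ?mulr_ge0 ?exprn_ge0 ?ler0n //.
  by rewrite mem_enum inE.
have := @expect_sample_notin R _ k (enum (nbr e x)) v (enum_uniq _).
rewrite mem_enum inE -cardE => /(_ exv) <-.
rewrite expect_dbind mulrC -expectZ.
apply: (@ler_expect _ _ predT); first by apply: is_distr_sample; rewrite -cardE.
  exact: all_predT.
move=> ws _; rewrite expect_ret; have [vws|vws] := boolP (v \in ws).
  by rewrite hit // mulr0.
rewrite mulr1 ler_nat push_B1_B2 (negbTE vws); apply/subset_leq_card/setDS.
by rewrite /= /upd; case: (eqVneq v x) => [->|_]; rewrite ?subsetUl.
Qed.

(** Induction on [k]: one more factor $1 - 1/d$ turns $d + k + 1$ into $d + k - (k+1)/d \le d +
    k$. *)
Lemma exprn_onem_inv_le (d k : nat) : (0 < d)%N ->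
  (1 - d%:R^-1) ^+ k * (d%:R + k%:R) <= d%:R :> R.
Proof.
move=> d_gt0; have dR : 0 < d%:R :> R by rewrite ltr0n.
elim: k => [|k IH]; first by rewrite addr0 mul1r.
have q_ge0 : 0 <= 1 - d%:R^-1 :> R by rewrite subr_ge0 invf_le1 // ler1n.
apply: le_trans IH; rewrite exprSr -mulrA ler_wpM2l ?exprn_ge0 //.
rewrite mulrBl mul1r mulrDr mulVf ?gt_eqF // -natr1.
have : 0 <= d%:R^-1 * (k%:R + 1) :> R by rewrite mulr_ge0 ?invr_ge0 ?addr_ge0 ?ler0n.
lra.
Qed.

(** The bound $E[M] \le |F(x)|/k$ is multiplied out by [k] to avoid division. It uses the processed
    sets [F], so that it also makes sense between the two halves of an insertion. *)
Definition run_inv k F e c (d : dist R (state T)) : Prop :=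
  [/\ is_distr d, all (fun p => state_inv F e c p.2) d &
     forall v x, x \in F v ->
       k%:R * expect d (fun st => #|F x :\: st_B2 st v|%:R) <= #|F x|%:R].

(** Only the processed set of [x] grows. For pairs [v], [z] with [z] other than [x], monotonicity of
    the stored balls suffices, or the pull from [y] when the arc is new. The case [z = x] is where
    sampling matters. *)
Lemma run_inv_endpoint k F e c x y d :
  simple_graph e -> (forall z, F z \subset nbr e z) ->
  nbr e x = y |: F x -> y \notin F x -> run_inv k F e c d ->
  run_inv k (upd F x (y |: F x)) e (c + (k + 4))
    (dbind d (endpoint_update (1 : R) k e x y)).
Proof.
move=> simple_e subF nbrx yF [d_distr d_inv d_miss].
have [sym irr] := simple_e.
have exy : y \in nbr e x by rewrite nbrx setU11.
rewrite inE in exy.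
have xy : x != y by apply: contraTneq exy => ->; rewrite irr.
have step st := is_distr_endpoint_update k st exy.
split; first exact: is_distr_bind.
  by apply: (all_dbind d_inv) => st; apply: endpoint_update_inv.
have mono v A :
    expect (dbind d (endpoint_update (1 : R) k e x y))
      (fun st => #|A :\: st_B2 st v|%:R) <=
    expect d (fun st => #|A :\: st_B2 st v|%:R).
  rewrite expect_dbind; apply: (@ler_expect _ _ predT) => // [|st _].
    exact: all_predT.
  rewrite -[leRHS](expect_const _ (step st)).
  apply: (@ler_expect _ _ (fun st' => st_B2 st v \subset st_B2 st' v) _ _ _
    (step st) (endpoint_update_B2 k e x y st v)) => st' sub.
  by rewrite ler_nat; apply/subset_leq_card/setDS.
have pull : expect (dbind d (endpoint_update (1 : R) k e x y))
      (fun st => #|F y :\: st_B2 st x|%:R) <= 0.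
  rewrite expect_dbind -[leRHS](expect_const _ d_distr).
  apply: (ler_expect d_distr d_inv) => st /andP[/forallP inv _].
  rewrite -[leRHS](expect_const _ (step st)).
  apply: (@ler_expect _ _ (fun st' => st_B1 st y \subset st_B2 st' x) _ _ _
    (step st) (endpoint_update_pull k e st xy)) => st' sub.
  rewrite lern0 cards_eq0 setD_eq0; apply: subset_trans sub.
  by case/and4P: (inv y) => /eqP -> *; apply: subsetUr.
move=> v z; rewrite {1 2 3}/upd; have [->|zx] := eqVneq z x; last first.
  have [->|vx] := eqVneq v x.
    rewrite in_setU1 => /orP[/eqP ->|zFx].
      by apply: le_trans (ler0n _ _); rewrite mulr_ge0_le0 ?ler0n.
    by apply: le_trans (d_miss x z zFx); rewrite ler_wpM2l ?ler0n.
  by move=> zFv; apply: le_trans (d_miss v z zFv); rewrite ler_wpM2l ?ler0n.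
have [->|vx xFv] := eqVneq v x.
  rewrite in_setU1 (negbTE xy) /= => /(subsetP (subF x)).
  by rewrite inE irr.
have exv : e x v by rewrite sym; have := subsetP (subF v) x xFv; rewrite inE.
have d_gt0 : (0 < #|nbr e x|)%N by apply/card_gt0P; exists y; rewrite inE.
set q : R := (1 - #|nbr e x|%:R^-1) ^+ k.
have q_ge0 : 0 <= q.
  by rewrite exprn_ge0 // subr_ge0 invf_le1 ?ltr0n // ler1n.
(* The new neighbour [y] adds at most one missing vertex; the push then scales the expectation by at
   most [q]. *)
have miss_le : expect (dbind d (endpoint_update (1 : R) k e x y))
      (fun st => #|nbr e x :\: st_B2 st v|%:R) <=
    q * (expect d (fun st => #|F x :\: st_B2 st v|%:R) + 1).
  rewrite -[X in _ + X](expect_const _ d_distr) -expectD -expectZ expect_dbind.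
  apply: (ler_expect d_distr d_inv) => st /andP[/forallP inv _].
  apply: le_trans (expect_endpoint_update_miss k exv _) _.
    case/and4P: (inv x) => /eqP -> _ _ _.
    by rewrite nbrx setUCA subsetUr.
  rewrite ler_wpM2l // natr1 ler_nat nbrx setDUl.
  apply: leq_trans (leq_card_setU _ _) _; rewrite addnC -addn1 leq_add2l.
  by rewrite -(cards1 y) subset_leq_card // subsetDl.
(* With $d = |N(x)|$ and $M$ the old number of missing vertices, $k q (E[M] + 1) \le q (d + k) \le
   d$. *)
rewrite -nbrx; apply: le_trans (exprn_onem_inv_le k d_gt0).
apply: le_trans (ler_wpM2l (ler0n _ _) miss_le) _.
rewrite mulrCA ler_wpM2l // mulrDr mulr1 lerD2r.
apply: le_trans (d_miss v x xFv) _.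
by rewrite ler_nat nbrx subset_leq_card // subsetUr.
Qed.

(** * The invariant along a whole run *)

Lemma run_inv_ext k F F' e e' c d : F =1 F' -> subrel e e' ->
  run_inv k F e c d -> run_inv k F' e' c d.
Proof.
move=> eqF sub [d_distr d_inv d_miss]; split=> // [|v x].
  apply: sub_all d_inv => p /andP[/forallP inv cost]; apply/andP; split=> //.
  apply/forallP => z; rewrite -eqF; case/and4P: (inv z) => -> -> -> /= B2.
  exact: subset_trans B2 (ball2S _ sub).
by rewrite -!eqF => /d_miss.
Qed.

Lemma run_inv_run_from k S e c d :
  simple_graph e -> valid_insertions e S -> run_inv k (nbr e) e c d ->
  run_inv k (nbr (graph_after e S)) (graph_after e S)
    (c + (k + 4).*2 * size S) (dbind d (run_from (1 : R) k e S)).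
Proof.
elim: S e c d => [|[a b] S IH] e c d simple_e.
  by move=> _; rewrite /= muln0 addn0 dbind_ret_r.
move=> /= /and3P[ab neab valid] inv.
set e' := add_edge e (a, b).
have simple_e' : simple_graph e' by apply: add_edge_simple.
have [sym _] := simple_e.
have -> : dbind d (run_from (1 : R) k e ((a, b) :: S)) =
    dbind (dbind (dbind d (endpoint_update (1 : R) k e' a b))
      (endpoint_update (1 : R) k e' b a)) (run_from (1 : R) k e' S).
  by rewrite [dbind (dbind d _) _]dbindA [RHS]dbindA.
rewrite (_ : (c + _ = c + (k + 4) + (k + 4) + (k + 4).*2 * size S)%N); last by lia.
apply: IH => //.
(* Processed sets between the two halves: [b] is recorded at [a], but [a] not yet at [b]. *)
pose F1 := upd (nbr e) a (b |: nbr e a).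
have nbrE z : nbr e' z = upd F1 b (a |: F1 b) z by apply: nbr_add_edge.
have F1b : F1 b = nbr e b by rewrite /F1 /upd eq_sym (negbTE ab).
apply: (@run_inv_ext _ (upd F1 b (a |: F1 b)) _ e') => //.
apply: run_inv_endpoint => //.
- move=> z; rewrite nbrE /upd; case: (eqVneq z b) => [->|_ //].
  exact: subsetUr.
- by rewrite nbrE /upd eqxx.
- by rewrite F1b inE sym.
apply: run_inv_endpoint => //.
- by move=> z; apply/subsetP => w; rewrite !inE => /(@add_edge_sub _ e (a, b)).
- by rewrite nbrE /upd (negbTE ab) /F1 /upd eqxx.
- by rewrite inE.
(* Before the first half the processed sets are those of the old graph; only the upper bound on the
   stored balls moves to the new one. *)
exact: (@run_inv_ext _ (nbr e) _ e _ _ _ _ (@add_edge_sub _ e (a, b)) inv).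
Qed.

(** Initially the stored balls are exact, so nothing is missing and the potential is zero. *)
Lemma run_inv_lazy_alg k S e :
  simple_graph e -> valid_insertions e S ->
  run_inv k (nbr (graph_after e S)) (graph_after e S)
    ((k + 4).*2 * size S) (lazy_alg (1 : R) k e S).
Proof.
move=> simple_e valid; rewrite -[X in run_inv _ _ _ X]add0n.
rewrite /lazy_alg -dbind_ret_l; apply: run_inv_run_from => //.
have sub2 z : z |: nbr e z \subset ball2 e z.
  apply/subsetP => w; rewrite in_setU1 inE => /orP[/eqP ->|ezw]; apply/ball2P.
    by constructor 1.
  by constructor 2.
split; first exact: is_distr_ret.
  rewrite /= andbT; apply/andP; split; last by rewrite /= big1.
  apply/forallP => z; rewrite /= sub2 subxx add0n /ball1 /deg setUC.
  by rewrite !eqxx.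
move=> v x; rewrite inE => evx; rewrite expect_ret.
rewrite (_ : _ :\: _ = set0) ?cards0 ?mulr0 ?ler0n //.
apply/eqP; rewrite setD_eq0; apply/subsetP => w; rewrite inE => exw.
by apply/ball2P; constructor 3; exists x.
Qed.

(** * Approximation ratio and amortized cost *)

Lemma expect_lazy_alg_B2 (g k : nat) (eps : R) S e v :
  simple_graph e -> valid_insertions e S ->
  (forall w, v != w ->
    #|nbr (graph_after e S) v :&: nbr (graph_after e S) w| <= g.+1)%N ->
  0 < eps -> 4 * (g%:R + 1) / eps <= k%:R ->
  (1 - eps) * #|ball2 (graph_after e S) v|%:R <=
  expect (lazy_alg (1 : R) k e S) (fun st => #|st_B2 st v|%:R).
Proof.
move=> simple_e valid codeg eps_gt0 k_ge.
have [d_distr d_inv d_miss] := run_inv_lazy_alg k simple_e valid.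
have [sym _] := graph_after_simple valid simple_e.
move: (graph_after e S) d_inv d_miss codeg sym => G d_inv d_miss codeg sym.
set d := lazy_alg _ _ _ _ in d_distr d_inv d_miss *.
have k_gt0 : 0 < k%:R :> R.
  apply: lt_le_trans k_ge; rewrite divr_gt0 // mulr_gt0 //.
  by rewrite natr1 ltr0n.
pose miss : R := \sum_(x in nbr G v) expect d (fun st => #|nbr G x :\: st_B2 st v|%:R).
have B2_ge : #|ball2 G v|%:R <= expect d (fun st => #|st_B2 st v|%:R) + miss.
  rewrite /miss -expect_sum -expectD -[leLHS](expect_const _ d_distr).
  apply: (ler_expect d_distr d_inv) => st /andP[/forallP inv _].
  rewrite -natr_sum -natrD ler_nat.
  rewrite -(cardsID (st_B2 st v) (ball2 G v)).
  apply: leq_add; first by rewrite subset_leq_card // subsetIr.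
  (* Union bound: a vertex of the 2-ball absent from the stored ball is neither [v] nor a neighbour
     of [v], hence a missing neighbour of some [x] in $N(v)$. *)
  apply: leq_trans (_ : #|\bigcup_(x in nbr G v) (nbr G x :\: st_B2 st v)| <= _)%N.
    apply/subset_leq_card/subsetP => w; rewrite inE => /andP[wB2].
    have /and4P[_ _ /subsetP lo _] := inv v.
    case/ball2P => [wv|evw|[x evx exw]].
    - by rewrite wv lo ?setU11 in wB2.
    - by rewrite lo ?inE ?evw ?orbT in wB2.
    - by apply/bigcupP; exists x; rewrite !inE ?wB2.
  exact: card_bigcup_leq.
have miss_le : k%:R * miss <= (2 * (g%:R + 1)) * #|ball2 G v|%:R.
  rewrite /miss mulr_sumr.
  apply: le_trans (ler_sum _ (G := fun x => #|nbr G x|%:R) _) _ => [x xv|].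
    exact: d_miss.
  rewrite -natr_sum natr1 -!natrM ler_nat mul2n; exact: sum_deg_nbr.
(* The choice of [k] gives $4(g+1) \le \varepsilon k$, twice the $2(g+1)$ required here. *)
have miss_eps : miss <= eps * #|ball2 G v|%:R.
  rewrite -(ler_pM2l k_gt0); apply: le_trans miss_le _.
  rewrite mulrA ler_wpM2r ?ler0n //.
  move: k_ge; rewrite ler_pdivrMr //.
  have := ler0n R g; lra.
lra.
Qed.

End LazyAlg.

(** The constant precedes all other data, so the $O$-bound is uniform. The sample size is rounded up
    to an integer, and time steps are prefixes of [S]. *)
Theorem theorem4p4 (R : realType) :
  exists2 C : R, 0 < C &
  forall (n : nat) (T : finType) (gamma : nat) (eps : R)
         (G0 : rel T) (S : seq (T * T)),
    #|T| = n ->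
    (gamma + 2 <= n)%N ->
    0 < eps < 1 ->
    simple_graph G0 ->
    valid_insertions G0 S ->
    locally_sparse (graph_after G0 S) gamma ->
    let k := `|Num.ceil (4 * (gamma%:R + 1) / eps)|%N in
    (forall (t : nat) (v : T), (t <= size S)%N ->
       let G_t := graph_after G0 (take t S) in
       let alg_t := lazy_alg (1 : R) k G0 (take t S) in
       surely alg_t (fun st => st_B2 st v \subset ball2 G_t v) /\
       (1 - eps) * #|ball2 G_t v|%:R
         <= expect alg_t (fun st => #|st_B2 st v|%:R)) /\
    surely (lazy_alg (1 : R) k G0 S)
      (fun st => (st_cost st)%:R <= C * ((gamma%:R + 1) / eps) * (size S)%:R).
Proof.
(* With $r = (\gamma+1)/\varepsilon \ge 1$ and $k \le 4r + 1$, one insertion costs at most $2(k+4)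
   \le 8r + 10 \le 18r$. *)
exists 18; first by rewrite ltr0n.
move=> n T g eps G0 S _ _ /andP[eps_gt0 eps_lt1] simple0 valid sparse k.
set r : R := (g%:R + 1) / eps.
have r_ge1 : 1 <= r.
  by rewrite ler_pdivlMr // mul1r; have := ler0n R g; lra.
have kE : k%:R = (Num.ceil (4 * r))%:~R :> R.
  rewrite /k -mulrA -/r natr_absz ger0_norm //.
  by rewrite ceil_ge0; lra.
have k_ge : 4 * r <= k%:R by rewrite kE ceil_ge.
have k_le : k%:R <= 4 * r + 1.
  rewrite kE; have := @ceilB1_lt R (4 * r); lra.
split=> [t v _|].
  have valid_t := valid_take t valid.
  split.
    have [_ d_inv _] := run_inv_lazy_alg R k simple0 valid_t.
    apply/surely_all; apply: sub_all d_inv => p /andP[/forallP /(_ v)].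
    by case/and4P.
  apply: (@expect_lazy_alg_B2 _ _ g) => // [w vw|]; last by rewrite -mulrA.
  (* Codegrees only grow with the edge set, so the bound for the final graph serves every prefix. *)
  apply: leq_trans (locally_sparse_codeg (graph_after_simple valid simple0) sparse vw).
  apply/subset_leq_card/setISS; apply/subsetP => z; rewrite !inE;
    exact: graph_after_take_sub.
have [_ d_inv _] := run_inv_lazy_alg R k simple0 valid.
apply/surely_all; apply: sub_all d_inv => p /andP[_ cost].
apply: le_trans (_ : ((k + 4).*2 * size S)%:R <= _).
  by rewrite ler_nat; apply: leq_trans cost; rewrite leq_addr.
rewrite natrM ler_wpM2r ?ler0n // -muln2 natrM natrD; lra.
Qed.
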